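(* Let $w=(w(n))_{n\ge 0}$ be a sequence of positive real numbers which is nondecreasing and satisfies $\sum_{n=0}^\infty \frac1{w(n)}=\infty$. Let $X=(X_n)_{n\ge 0}$ be the Vertex Reinforced Random Walk on $\mathbb{Z}$ with weight $w$, let $\mathbb{P}$ be its law, and let $R'$ be the set of sites visited infinitely often by $X$. Then $$\mathbb{P}(|R'|=5)>0\quad\Longrightarrow\quad \beta_c(w)<+\infty .$$
   Context: **Vertex Reinforced Random Walk (VRRW).** Given a weight $w=(w(n))_{n\ge0}$ (positive reals), the VRRW on $\mathbb{Z}$ is the process $(X_n)_{n\ge 0}$ with $X_0=0$ and, for all $n\ge 0$ and $x\in\mathbb{Z}$, on the event $\{X_n=x\}$, $$\mathbb{P}(X_{n+1}=x\pm1\mid\mathcal{F}_n)=\frac{w(Z_n(x\pm1))}{w(Z_n(x+1))+w(Z_n(x-1))},$$ where $\mathcal{F}_n=\sigma(X_0,\dots,X_n)$ and $Z_n(y)=z_0(y)+\sum_{k=1}^n \mathbf{1}\{X_k=y\}$, with initial local times $z_0(0)=1$ and $z_0(y)=0$ for $y\ne0$. Let $Z_\infty(x)=\lim_{n\to\infty}Z_n(x)$ and $R'=\{x\in\mathbb{Z}: Z_\infty(x)=\infty\}$. **The parameter $\beta_c(w)$.** Extend $w$ to $[0,\infty)$ by $w(t):=w(\lfloor t\rfloor)$ and set $W(t):=\int_0^t\frac{du}{w(u)}$. Since $\sum 1/w(n)=\infty$, $W$ is a bijection of $[0,\infty)$ onto itself; let $W^{-1}$ be its inverse, with the convention $W^{-1}(u)=0$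 for $u<0$. For $\beta\in\mathbb{R}$ define $$J_\beta(w):=\int_0^\infty\frac{dx}{w\big(W^{-1}(2W(x)+\beta)\big)},\qquad \beta_c(w):=\inf\{\beta\in\mathbb{R}: J_\beta(w)<\infty\}\in[-\infty,+\infty],$$ with $\inf\emptyset=+\infty$. *)

(* Defs.v *)
From HB Require Import structures.
From mathcomp Require Import all_boot all_order all_algebra.
From mathcomp Require Import all_classical all_reals all_analysis.
Set Implicit Arguments.
Unset Strict Implicit.
Unset Printing Implicit Defensive.
Import Order.TTheory GRing.Theory Num.Theory.
Import numFieldNormedType.Exports.
Local Open Scope classical_set_scope.
Local Open Scope ring_scope.

Section Weight.
Variables (R : realType) (w : nat -> R).

(* Only used for t >= 0, where Num.truncn is the floor. *)
Definition wext (t : R) : R := w (Num.truncn t).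

Definition bigW (t : R) : R :=
  (\int[@lebesgue_measure R]_(u in `[0%R, t]) (wext u)^-1)%R.

Definition bigW_inv (u : R) : R :=
  if u < 0 then 0 else 'pinv_(fun=> 0) `[0, +oo[ bigW u.

Definition Jbeta (beta : R) : \bar R :=
  (\int[@lebesgue_measure R]_(x in `[0%R, +oo[)
     ((wext (bigW_inv (2 * bigW x + beta)%R))^-1)%:E)%E.

(* ereal_inf set0 = +oo, as required by the convention inf emptyset = +oo. *)
Definition beta_c : \bar R :=
  ereal_inf [set beta%:E | beta in [set beta : R | (Jbeta beta < +oo)%E]].

End Weight.

Section CondProb.
Context d (T : measurableType d) (R : realType).

(* Q is a version of the conditional probability P(E | F), for a
   sub-sigma-algebra F given as a set of sets. *)
Definition is_cond_prob (P : probability T R) (F : set (set T)) (E : set T)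
    (Q : T -> R) : Prop :=
  [/\ forall B : set R, measurable B -> F (Q @^-1` B),
      P.-integrable setT (EFin \o Q) &
      forall A, F A -> (\int[P]_(o in A) (Q o)%:E = P (A `&` E))%E].

End CondProb.

Section VRRW.
Context d (T : measurableType d) (R : realType).

(* int carries the discrete sigma-algebra: every B : set int is measurable. *)
Definition natural_filtration (X : nat -> T -> int) (n : nat) : set (set T) :=
  <<s [set A | exists k (B : set int), (k <= n)%N /\ A = X k @^-1` B] >>.

(* (y == 0) is the initial local time z_0(y). *)
Definition local_time (X : nat -> T -> int) (n : nat) (y : int) (o : T) : nat :=
  ((y == 0%R) + \sum_(1 <= k < n.+1) (X k o == y))%N.

Definition local_time_oo (X : nat -> T -> int) (y : int) (o : T) : \bar R :=
  limn (fun n => ((local_time X n y o)%:R : R)%:E).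

Definition inf_visited (X : nat -> T -> int) (o : T) : set int :=
  [set y | local_time_oo X y o = +oo%E].

Definition is_VRRW (P : probability T R) (w : nat -> R)
    (X : nat -> T -> int) : Prop :=
  [/\ forall n (B : set int), measurable (X n @^-1` B),
      forall o, X 0%N o = 0 &
      forall (n : nat) (x y : int), y = x + 1 \/ y = x - 1 ->
        exists Q : T -> R,
          is_cond_prob P (natural_filtration X n) [set o | X n.+1 o = y] Q /\
          {ae P, forall o, X n o = x ->
             Q o = w (local_time X n y o) /
                   (w (local_time X n (x + 1) o) +
                    w (local_time X n (x - 1) o))}].

End VRRW.
Arguments inf_visited {d T} R X o.

(* Main.v *)
Require Import Defs.
From mathcomp Require Import all_boot all_order all_algebra.
From mathcomp Require Import all_classical all_reals all_analysis.
From mathcomp Require Import measurable_realfun ring lra zify.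
Import Order.TTheory GRing.Theory Num.Theory.
Import numFieldNormedType.Exports.
Local Open Scope classical_set_scope.
Local Open Scope card_scope.
Local Open Scope ring_scope.
Set Implicit Arguments.
Unset Strict Implicit.
Unset Printing Implicit Defensive.

(** The walk stays near five sites [a - 2, ..., a + 2] only if the site [a + 3]
    (and likewise [a - 3]) is visited finitely often. Write [Z y] for the local
    time of [y] and [Wsum n] for the sum of [1 / w i] over [i < n].

    At a visit to [a + 2] the probability of stepping to [a + 3] is at least a
    constant times [1 / w (Z (a + 1))]. By conditional Borel-Cantelli, the sum of
    [1 / w (Z (a + 1))] over the visits to [a + 2] is finite
    ([summable_far_visits]). A second use of the same principle, now for the
    steps from [a + 1] to [a + 2], bounds the sum of
    [1 / (w (Z a) * w (Z (a + 1)))] over the visits to [a + 1]. Since [Z a] is at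
    most [Z (a + 1) + Z (a - 1) + 1], this forces the sum of [1 / w n ^ 2] to
    converge ([summable_winv2]), a property of the weight alone which bounds the
    quadratic variations of the natural martingales of the walk.

    At [a + 1], the difference of the steps towards [a], weighted by
    [1 / w (Z a)], and of the steps towards [a + 2], weighted by
    [1 / w (Z (a + 2))], is such a martingale, hence bounded. It follows that, up
    to an additive constant, [Wsum (Z a) <= Wsum (Z (a + 2)) + Wsum (Z (a - 2))]
    ([Wsum_center_le]). Moreover [Wsum (Z (a + 1)) <= Wsum (Z a)] up to a
    constant, because entries to [a + 1] from [a + 2] contribute a convergent sum
    ([Wsum_near_le]). Let [j] be a level of the larger of [Z (a + 2)] and
    [Z (a - 2)]; when it is reached at [a + 2], say,
    [Wsum (Z (a + 1)) <= 2 * Wsum j + beta]. Summing over [j],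
    [summable_far_visits] on both sides gives the convergence of the sum over [j]
    of [1 / w (W^-1 (2 * W j + beta))], hence [Jbeta w beta < +oo]
    ([summable_levels], [Jbeta_le]).

    The probabilistic input is reduced to a single trajectory. Ville's maximal
    inequality, proved directly on cylinder events ([ville_cyl]), gives the almost
    sure bounds collected in [typical]; since the event has positive
    probability, some trajectory in it is typical, and the rest is
    deterministic. *)

(** * Histories and cylinder events *)

Section History.

(** Most recent site first. *)
Fixpoint hist (x : nat -> int) (n : nat) : seq int :=
  if n is n'.+1 then x n :: hist x n' else [:: x 0%N].

Lemma head_hist x n : head 0 (hist x n) = x n.
Proof. by case: n. Qed.

(** The initial local time of the origin is the occurrence of [x 0]. *)
Lemma count_hist x n y : x 0%N = 0 ->
  count_mem y (hist x n) = ((y == 0%R) + \sum_(1 <= k < n.+1) (x k == y))%N.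
Proof.
move=> x0; elim: n => [|n IH]; first by rewrite big_geq //= x0 eq_sym addn0.
by rewrite big_nat_recr //= IH addnC addnA.
Qed.

Lemma count_hist_le x m n y :
  (m <= n)%N -> (count_mem y (hist x m) <= count_mem y (hist x n))%N.
Proof.
move=> /subnKC <-; elim: (n - m)%N => [|k IH]; first by rewrite addn0.
by rewrite addnS (leq_trans IH) //= leq_addl.
Qed.

Definition adjacent (u v : int) := v = u + 1 \/ v = u - 1.

End History.

Lemma g_sigma_algebraI (T : Type) (G : set (set T)) (A B : set T) :
  <<s G >> A -> <<s G >> B -> <<s G >> (A `&` B).
Proof.
have C E : <<s G >> E -> <<s G >> (~` E).
  by rewrite -setTD; exact: sigma_algebraCD.
move=> GA GB; rewrite -[A `&` B]setCK setCI -bigcup2E; apply: (C).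
apply: sigma_algebra_bigcup => -[|[|n]] /=; [exact: C|exact: C|].
exact: sigma_algebra0.
Qed.

Section Cylinders.
Context (R : realType) (w : nat -> R) (w_gt0 : forall n, 0 < w n).
Context (d : measure_display) (T : measurableType d) (P : probability T R).
Context (X : nat -> T -> int) (X_VRRW : is_VRRW P w X).

Local Notation H n t := (hist (X^~ t) n).

Definition trans (h : seq int) (y : int) : R :=
  let x := head 0 h in
  w (count_mem y h) / (w (count_mem (x + 1) h) + w (count_mem (x - 1) h)).

Lemma trans_ge0 h y : 0 <= trans h y.
Proof. by rewrite divr_ge0 ?addr_ge0 // ltW. Qed.

Lemma trans_sum h : trans h (head 0 h + 1) + trans h (head 0 h - 1) = 1.
Proof. by rewrite -mulrDl divff // lt0r_neq0 // addr_gt0. Qed.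

Lemma cylS n h y : [set t | H n.+1 t = y :: h] =
  [set t | H n t = h] `&` [set t | X n.+1 t = y].
Proof.
by apply/seteqP; split => t /=; [case=> -> -> | case=> -> ->].
Qed.

Lemma filtrationS n : natural_filtration X n `<=` natural_filtration X n.+1.
Proof.
apply: smallest_sub; first exact: smallest_sigma_algebra.
move=> A [k [B [kn ->]]]; apply: sub_sigma_algebra.
by exists k, B; split=> //; exact: leqW.
Qed.

Lemma filtration_cyl n h : natural_filtration X n [set t | H n t = h].
Proof.
have XF m x : natural_filtration X m [set t | X m t = x].
  by apply: sub_sigma_algebra; exists m, [set x].
elim: n h => [|n IH] [|x h].
- rewrite (_ : mkset _ = set0); first exact: sigma_algebra0.
  by apply/seteqP; split.
- have [->|h0] := eqVneq h [::].
    rewrite (_ : mkset _ = [set t | X 0%N t = x]) //.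
    by apply/seteqP; split => t /= => [[->]|->].
  rewrite (_ : mkset _ = set0); first exact: sigma_algebra0.
  by apply/seteqP; split=> t //= [_ /esym/eqP]; rewrite (negbTE h0).
- rewrite (_ : mkset _ = set0); first exact: sigma_algebra0.
  by apply/seteqP; split.
- rewrite cylS; apply: g_sigma_algebraI; [exact: (filtrationS (IH h)) | exact: XF].
Qed.

Lemma measurable_cyl n h : measurable [set t | H n t = h].
Proof.
have [Xm _ _] := X_VRRW.
have := @filtration_cyl n h.
apply: smallest_sub; first exact: sigma_algebra_measurable.
by move=> A [k [B [_ ->]]]; exact: Xm.
Qed.

(** A history takes countably many values, so every property of it is an
    event. *)
Lemma measurable_hist n (Q : seq int -> Prop) : measurable [set t | Q (H n t)].
Proof.
rewrite (_ : mkset _ = \bigcup_h ([set t | H n t = h] `&` [set t | Q h])); last first.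
  by apply/seteqP; split=> [t Qo|t [h _ /= [->]]] //; exists (H n t).
apply: countable_bigcupT_measurable => [|h]; first exact: countableP.
apply: measurableI; first exact: measurable_cyl.
have [Qh|nQh] := pselect (Q h).
  by rewrite (_ : mkset _ = setT) //; apply/seteqP; split.
by rewrite (_ : mkset _ = set0) //; apply/seteqP; split.
Qed.

(** On a cylinder the transition probability is constant, so integrating the
    conditional probability over it gives a product: from here on the law of
    the walk is used only through this formula. *)
Lemma cyl_step n (h : seq int) (y : int) : y = head 0 h + 1 \/ y = head 0 h - 1 ->
  P [set t | H n.+1 t = y :: h] = ((trans h y)%:E * P [set t | H n t = h])%E.
Proof.
move=> yh; have [_ X0 /(_ n _ _ yh) [Q [[Qm Qi QP] Qae]]] := X_VRRW.
have mA := measurable_cyl n h.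
rewrite cylS -(QP _ (@filtration_cyl n h)).
rewrite -integral_cst //; apply: ae_eq_integral => //.
- exact: (measurable_int _ (integrableS measurableT mA (@subsetT _ _) Qi)).
- apply: filterS Qae => t Qo /= th; congr EFin.
  have Xno : X n t = head 0 h by rewrite -th head_hist.
  have ltE z : local_time X n z t = count_mem z h.
    by rewrite -th count_hist.
  by rewrite Qo // !ltE.
Qed.

End Cylinders.

(** * Almost sure bounds for supermartingales of the history *)

Lemma ae_forall_countable (R : realType) (d : measure_display)
    (T : measurableType d) (P : probability T R) (I : countType)
    (Q : I -> T -> Prop) :
  (forall i, {ae P, forall t, Q i t}) -> {ae P, forall t, forall i, Q i t}.
Proof.
move=> Qae; suff : {ae P, forall t, forall k i, unpickle k = Some i -> Q i t}.
  by apply: filterS => t Qt i; apply: (Qt (pickle i)); rewrite pickleK.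
apply: ae_foralln => k; case: unpickle => [i|]; last exact: nearW.
by apply: filterS (Qae i) => t Qit _ [<-].
Qed.

Section Ville.
Context (R : realType) (w : nat -> R) (w_gt0 : forall n, 0 < w n).
Context (d : measure_display) (T : measurableType d) (P : probability T R).
Context (X : nat -> T -> int) (X_VRRW : is_VRRW P w X).

Local Notation H n t := (hist (X^~ t) n).
Local Notation pr A := (fine (P A)).
Local Notation cyl n h := [set t | H n t = h].
Local Notation up h := (head 0 h + 1).
Local Notation down h := (head 0 h - 1).

Lemma prE A : measurable A -> (pr A)%:E = P A.
Proof. by move=> mA; rewrite fineK // fin_num_measure. Qed.

Lemma pr_ge0 A : 0 <= pr A.
Proof. by rewrite fine_ge0. Qed.

Lemma pr_le A B : measurable A -> measurable B -> A `<=` B -> pr A <= pr B.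
Proof. by move=> mA mB AB; rewrite -lee_fin !prE // le_measure ?inE. Qed.

Lemma prU A B : measurable A -> measurable B -> pr (A `|` B) <= pr A + pr B.
Proof.
move=> mA mB; rewrite -lee_fin EFinD !prE //; first exact: measureU2.
exact: measurableU.
Qed.

Definition adjacent_step n : set T := [set t | adjacent (X n t) (X n.+1 t)].

Lemma measurable_adjacent_step n : measurable (adjacent_step n).
Proof.
have := measurable_hist X_VRRW n.+1 (fun h =>
  let x := head 0 (behead h) in head 0 h = x + 1 \/ head 0 h = x - 1).
by congr measurable; apply/seteqP; split=> t /=; rewrite head_hist.
Qed.

(** The two transition probabilities add up to [1]. *)
Lemma cyl_adjacent_step n h :
  pr (cyl n h `&` ~` adjacent_step n) = 0.
Proof.
have mc m g := measurable_cyl X_VRRW m g.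
have mN : measurable (cyl n h `&` ~` adjacent_step n).
  by apply: measurableI => //; apply: measurableC; exact: measurable_adjacent_step.
have cE : cyl n h = (cyl n h `&` ~` adjacent_step n) `|`
    (cyl n.+1 (up h :: h) `|` cyl n.+1 (down h :: h)).
  rewrite !cylS -setIUr -setIUr; apply/seteqP; split=> [t th|t [//]].
  split=> //; rewrite /adjacent_step /adjacent /=.
  have -> : X n t = head 0 h by rewrite -th head_hist.
  by case: (EM (X n.+1 t = up h \/ X n.+1 t = down h)); [right|left].
have : P (cyl n h) = (P (cyl n h `&` ~` adjacent_step n) +
    (P (cyl n.+1 (up h :: h)) + P (cyl n.+1 (down h :: h))))%E.
  rewrite {1}cE measureU //; last 2 first.
  - exact: measurableU.
  - rewrite !cylS -setIUr setIACA setIid; apply/seteqP; split=> t //=.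
    rewrite /adjacent_step /adjacent /= => -[th].
    have -> : X n t = head 0 h by rewrite -th head_hist.
    by case.
  rewrite measureU //; apply/seteqP; split=> t //= -[[-> _] [+ _]].
  by move=> /addrI.
rewrite !(cyl_step X_VRRW) //; [|by right|by left].
rewrite -(prE (mc n h)) -(prE mN) -!EFinM -!EFinD => -[].
rewrite -mulrDl trans_sum // mul1r => /eqP.
by rewrite -subr_eq subrr eq_sym => /eqP.
Qed.

Lemma ae_adjacent_step : {ae P, forall t, forall n, adjacent_step n t}.
Proof.
suff : {ae P, forall t, forall i : nat * seq int, H i.1 t = i.2 -> adjacent_step i.1 t}.
  by apply: filterS => t nt n; exact: (nt (n, H n t)).
apply: ae_forall_countable => -[n h] /=.
have mN : measurable (cyl n h `&` ~` adjacent_step n).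
  apply: measurableI; first exact: (measurable_cyl X_VRRW).
  by apply: measurableC; exact: measurable_adjacent_step.
exists (cyl n h `&` ~` adjacent_step n); split=> //.
- by have := prE mN; rewrite cyl_adjacent_step => /esym.
- by move=> t /= /not_implyP.
Qed.

Variable V : seq int -> R.
Hypothesis V_ge0 : forall h, 0 <= V h.
Hypothesis V_super : forall h : seq int, h != [::] ->
  trans w h (up h) * V (up h :: h) + trans w h (down h) * V (down h :: h) <= V h.

Let reach (l : R) n N : set T :=
  [set t | exists k, (k <= N)%N /\ l <= V (H (n + k)%N t)].

Let measurable_reach l n N : measurable (reach l n N).
Proof.
rewrite (_ : reach _ _ _ = \bigcup_k
    (if (k <= N)%N then [set t | l <= V (H (n + k)%N t)] else set0)).
  apply: bigcupT_measurable => k; case: ifP => // _.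
  exact: (measurable_hist X_VRRW _ (fun h => l <= V h)).
apply/seteqP; split=> [t [k [kN lV]]|t [k _]].
  by exists k => //; rewrite kN.
by case: ifP => // kN lV; exists k.
Qed.

(** Ville's maximal inequality, conditionally on a cylinder: induction on the
    horizon [N] with the cylinder varying only conditions on the next step. *)
Lemma ville_cyl (l : R) n N (h : seq int) : 0 < l -> h != [::] ->
  l * pr (cyl n h `&` reach l n N) <= V h * pr (cyl n h).
Proof.
move=> l0; have mc m g := measurable_cyl X_VRRW m g.
have mcr m g M : measurable (cyl m g `&` reach l m M) by exact: measurableI.
have big m M g : l <= V g ->
    l * pr (cyl m g `&` reach l m M) <= V g * pr (cyl m g).
  move=> lV; apply: ler_pM => //; [exact: ltW|exact: pr_ge0|].
  by apply: pr_le => //; exact: subIsetl.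
elim: N n h => [|N IH] n h h0; have [lV|lV] := leP l (V h); try exact: big.
  rewrite (_ : _ `&` _ = set0) ?measure0 /= ?mulr0.
    by rewrite mulr_ge0 ?pr_ge0.
  apply/seteqP; split=> t //= [th [k []]].
  by rewrite leqn0 => /eqP ->; rewrite addn0 th leNgt lV.
have sub : cyl n h `&` reach l n N.+1 `<=`
    (cyl n h `&` ~` adjacent_step n) `|`
    ((cyl n.+1 (up h :: h) `&` reach l n.+1 N) `|`
     (cyl n.+1 (down h :: h) `&` reach l n.+1 N)).
  move=> t [th [[|k] [kN lVk]]].
    by move: lVk; rewrite addn0 th leNgt lV.
  have r : reach l n.+1 N t by exists k; rewrite addSnnS.
  have [|not_adj] := pselect (adjacent_step n t); last by left.
  have Xt : X n t = head 0 h by rewrite -th head_hist.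
  rewrite /adjacent_step /adjacent /= Xt => -[] s; right; [left|right].
    by split=> //=; rewrite s th.
  by split=> //=; rewrite s th.
have mN : measurable (cyl n h `&` ~` adjacent_step n).
  by apply: measurableI => //; apply: measurableC; exact: measurable_adjacent_step.
have le1 : pr (cyl n h `&` reach l n N.+1) <=
    pr (cyl n.+1 (up h :: h) `&` reach l n.+1 N) +
    pr (cyl n.+1 (down h :: h) `&` reach l n.+1 N).
  apply: (le_trans (pr_le _ _ sub)) => //.
    by do 2 apply: measurableU => //.
  apply: (le_trans (prU _ _)) => //; first exact: measurableU.
  by rewrite cyl_adjacent_step add0r prU.
apply: (le_trans (ler_wpM2l (ltW l0) le1)); rewrite mulrDr.
apply: (le_trans (lerD (IH _ _ _) (IH _ _ _))) => //.
have pE y : y = up h \/ y = down h -> pr (cyl n.+1 (y :: h)) = trans w h y * pr (cyl n h).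
  move=> yh; apply: EFin_inj; rewrite EFinM !prE //; exact: (cyl_step X_VRRW).
rewrite !pE; [|by right|by left].
by have := ler_wpM2r (pr_ge0 (cyl n h)) (V_super h0); lra.
Qed.

(** The maximal inequality gives [P (sup V >= l) <= V [:: 0] / l]; let [l] tend
    to infinity. *)
Lemma ae_bounded : {ae P, forall t, exists C : R, forall n, V (H n t) <= C}.
Proof.
pose A (l : R) : set T := [set t | exists n, l <= V (H n t)].
have mA l : measurable (A l).
  rewrite (_ : A l = \bigcup_n [set t | l <= V (H n t)]); last first.
    by apply/seteqP; split=> [t [n]|t [n _]]; exists n.
  apply: bigcupT_measurable => k.
  exact: (measurable_hist X_VRRW _ (fun h => l <= V h)).
have X0 : forall t, X 0%N t = 0 by case: X_VRRW.
have c0 : cyl 0%N [:: 0] = setT.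
  by apply/seteqP; split => t //= _; rewrite X0.
have rle (l : R) N : 0 < l -> l * pr (reach l 0%N N) <= V [:: 0].
  move=> l0; have := @ville_cyl l 0%N N [:: 0] l0 isT.
  by rewrite c0 setTI probability_setT /= mulr1.
have Ale (l : R) : 0 < l -> l * pr (A l) <= V [:: 0].
  move=> l0.
  have AE : A l = \bigcup_N reach l 0%N N.
    apply/seteqP; split=> [t [n ln]|t [N _ [k [_ lk]]]]; last by exists k.
    by exists n => //; exists n.
  have cv : (P \o reach l 0%N) x @[x --> \oo] --> P (A l).
    rewrite AE; apply: nondecreasing_cvg_mu => //; first by rewrite -AE.
    move=> m n mn; apply/subsetPset => t [k [km lk]]; exists k; split=> //.
    exact: leq_trans mn.
  rewrite mulrC -ler_pdivlMr // -lee_fin prE //.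
  rewrite -(cvg_lim _ cv) //; apply: lime_le; first by apply: cvgP; exact: cv.
  by apply: nearW => N /=; rewrite -prE // lee_fin ler_pdivlMr // mulrC rle.
pose N := \bigcap_n A (n.+1%:R).
have mN : measurable N by apply: bigcapT_measurable.
exists N; split=> //.
  rewrite -[RHS]/(0%:E) -[LHS](prE mN); congr EFin.
  apply/eqP; rewrite eq_le pr_ge0 andbT.
  rewrite leNgt; apply/negP => N0.
  pose m := Num.truncn (V [:: 0] / pr N).
  have := Ale m.+1%:R (ltr0Sn _ _); rewrite leNgt => /negP; apply.
  rewrite (@lt_le_trans _ _ (m.+1%:R * pr N)) //.
    by rewrite -ltr_pdivrMr // truncnS_gt.
  apply: ler_wpM2l => //; apply: pr_le => // t; exact.
move=> t /= nC n _ /=; apply: contrapT => /forallNP nA; apply: nC.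
exists n.+1%:R => k; have /negP := nA k; rewrite -ltNge => /ltW //.
Qed.

End Ville.

Section Compensation.
Context (R : realType) (w : nat -> R) (w_gt0 : forall n, 0 < w n).
Context (d : measure_display) (T : measurableType d) (P : probability T R).
Context (X : nat -> T -> int) (X_VRRW : is_VRRW P w X).

Local Notation H n t := (hist (X^~ t) n).
Local Notation up h := (head 0 h + 1).
Local Notation down h := (head 0 h - 1).

(** The increments start at the first step: [F] is not applied to the empty
    history, which has no current site. *)
Fixpoint path_sum (F : seq int -> int -> R) (h : seq int) : R :=
  if h is y :: g then (if g is [::] then 0 else F g y + path_sum F g) else 0.

Lemma path_sum_hist F x n :
  path_sum F (hist x n) = \sum_(0 <= k < n) F (hist x k) (x k.+1).
Proof.
elim: n => [|n IH]; first by rewrite big_geq.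
rewrite big_nat_recr //= -IH addrC; by case: n {IH}.
Qed.

(** The coefficient [2] makes [1 + y <= expR y] at [y = 2 * x ^ 2 - x] sufficient. *)
Lemma exp_quad_le (x : R) : - 2^-1 <= x -> expR (x - 2 * x ^+ 2) <= 1 + x.
Proof.
move=> xge.
have x1 : 0 < 1 + x by lra.
rewrite -[x - _]opprK expRN -[leRHS]invrK lef_pV2 ?posrE ?expR_gt0 ?invr_gt0 //.
apply: le_trans (expR_ge1Dx _).
rewrite -(ler_pM2r x1) mulVf ?lt0r_neq0 //.
have -> : (1 + - (x - 2 * x ^+ 2)) * (1 + x) = 1 + x ^+ 2 * (1 + 2 * x) by ring.
by rewrite lerDl mulr_ge0 ?sqr_ge0 //; lra.
Qed.

(** If the increments [xi] are centered given the past, then the exponential of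
    the sum of the [xi - 2 * xi ^ 2] is a supermartingale by [exp_quad_le],
    hence bounded. The squares are those of the realized increments, rather than
    their conditional expectations: along a trajectory they sum up over the
    levels of a local time. *)
Lemma ae_compensated (xi : seq int -> int -> R) :
  (forall h y, `|xi h y| <= 2^-1) ->
  (forall h, trans w h (up h) * xi h (up h) +
             trans w h (down h) * xi h (down h) = 0) ->
  {ae P, forall t, exists C : R, forall n,
    \sum_(0 <= k < n)
      (xi (H k t) (X k.+1 t) - 2 * xi (H k t) (X k.+1 t) ^+ 2) <= C}.
Proof.
move=> xi_le xi0.
pose F h y := xi h y - 2 * xi h y ^+ 2.
have V_ge0 h : 0 <= expR (path_sum F h) by exact: expR_ge0.
have VS h y : h != [::] ->
    expR (path_sum F (y :: h)) <= (1 + xi h y) * expR (path_sum F h).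
  case: h => // x h _; rewrite [path_sum F (y :: _)]/= -/(path_sum F (x :: h)) expRD.
  apply: ler_wpM2r => //; apply: exp_quad_le.
  by have := xi_le (x :: h) y; rewrite ler_norml => /andP[].
have super h : h != [::] -> trans w h (up h) * expR (path_sum F (up h :: h)) +
    trans w h (down h) * expR (path_sum F (down h :: h)) <= expR (path_sum F h).
  move=> h0.
  have l1 := ler_wpM2l (trans_ge0 w_gt0 h (up h)) (VS h (up h) h0).
  have l2 := ler_wpM2l (trans_ge0 w_gt0 h (down h)) (VS h (down h) h0).
  apply: (le_trans (lerD l1 l2)).
  rewrite !mulrA -mulrDl ger_pMl ?expR_gt0 //.
  have := xi0 h; have := trans_sum w_gt0 h; lra.
apply: filterS (ae_bounded w_gt0 X_VRRW V_ge0 super) => t [C VC]; exists C => n.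
rewrite -(path_sum_hist F (X^~ t)); apply: le_trans (VC n).
by apply: le_trans (expR_ge1Dx _); rewrite lerDr.
Qed.

(** A conditional Borel-Cantelli lemma: apply [ae_compensated] to the compensated
    indicators, scaled by [1 / 4] so that the quadratic term takes away only
    half of the linear one. *)
Lemma ae_compensator_le (u v : int) (c : seq int -> R) : adjacent u v ->
  (forall h, 0 <= c h <= 1) ->
  {ae P, forall t, exists C : R, forall n,
    \sum_(0 <= k < n) (X k t == u)%:R * c (H k t) * trans w (H k t) v <=
    C + 3 * \sum_(0 <= k < n) (X k t == u)%:R * (X k.+1 t == v)%:R * c (H k t)}.
Proof.
move=> uv c01.
pose xi h y := 4^-1 * (head 0 h == u)%:R * c h * (trans w h v - (y == v)%:R) : R.
have p01 h y : y = up h \/ y = down h -> 0 <= trans w h y <= 1.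
  move=> yh; rewrite trans_ge0 //=; have := trans_sum w_gt0 h.
  have := trans_ge0 w_gt0 h (up h); have := trans_ge0 w_gt0 h (down h).
  by case: yh => ->; lra.
have pv h : head 0 h = u -> 0 <= trans w h v <= 1.
  by move=> hu; apply: p01; rewrite hu.
have xi_le h y : `|xi h y| <= 2^-1.
  rewrite /xi; case: eqP => [/pv p|_]; last by rewrite !(mulr0, mul0r) normr0; lra.
  rewrite mulr1 !normrM; have c1 := c01 h.
  have n1 : `|trans w h v - (y == v)%:R| <= 1.
    by rewrite ler_norml; case: eqP => _ /=; lra.
  have n2 : `|c h| <= 1 by rewrite ler_norml; lra.
  have := ler_pM (normr_ge0 _) (normr_ge0 _) n2 n1.
  rewrite -mulrA ger0_norm; lra.
have xi0 h : trans w h (up h) * xi h (up h) + trans w h (down h) * xi h (down h) = 0.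
  rewrite /xi; case: eqP => [hu|_]; last by rewrite !(mulr0, mul0r) addr0.
  have := trans_sum w_gt0 h; rewrite hu.
  have ne : u + 1 != u - 1 by apply/eqP; lia.
  case: uv => ->; rewrite eqxx ?(negbTE ne) 1?eq_sym ?(negbTE ne) /=.
    by move=> e; rewrite -[trans w h (u + 1)](addrK (trans w h (u - 1))) e; ring.
  by move=> e; rewrite -[trans w h (u + 1)](addrK (trans w h (u - 1))) e; ring.
(* [8] is the inverse of [1 / 4 - 2 * (1 / 4) ^ 2]. *)
apply: filterS (ae_compensated xi_le xi0) => t [C SC]; exists (8 * C) => n.
suff le1 k : (X k t == u)%:R * c (H k t) * trans w (H k t) v -
    3 * ((X k t == u)%:R * (X k.+1 t == v)%:R * c (H k t)) <=
    8 * (xi (H k t) (X k.+1 t) - 2 * xi (H k t) (X k.+1 t) ^+ 2).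
  rewrite -lerBlDr mulr_sumr -sumrB.
  apply: (@le_trans _ _ (\sum_(0 <= k < n)
      8 * (xi (H k t) (X k.+1 t) - 2 * xi (H k t) (X k.+1 t) ^+ 2))).
    by apply: ler_sum => k _; exact: le1.
  by rewrite -mulr_sumr ler_pM2l.
rewrite /xi head_hist; case: eqP => [Xu|_]; last by rewrite !(mulr0, mul0r); lra.
have := pv (H k t); rewrite head_hist => /(_ Xu) p; have c1 := c01 (H k t).
move: (trans _ _ _) p (c (H k t)) c1 => q /andP[q0 q1] a /andP[a0 a1].
have aa : a ^+ 2 <= a by rewrite expr2 ler_piMl.
case: eqP => _ /=.
  have q2 : (1 - q) ^+ 2 <= 1 + q by nra.
  have := ler_pM (sqr_ge0 a) (sqr_ge0 (1 - q)) aa q2; lra.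
have := ler_pM (sqr_ge0 a) (sqr_ge0 q) aa (_ : q ^+ 2 <= q).
rewrite expr2 ler_piMl // => /(_ isT); lra.
Qed.

(** Each of the two exits of [u], weighted by the inverse weight of its target,
    has conditional expectation [1 / (w (Z (u + 1)) + w (Z (u - 1)))]; their
    difference is a martingale, hence at most a constant plus a multiple of its
    realized quadratic variation. *)
Lemma ae_inward_le_outward (u v : int) (v' := u + u - v) : adjacent u v ->
  {homo w : m n / (m <= n)%N >-> m <= n} ->
  {ae P, forall t, exists C : R, forall n,
    \sum_(0 <= k < n) (X k t == u)%:R * (X k.+1 t == v')%:R
       / w (count_mem v' (H k t)) <=
    C + \sum_(0 <= k < n) (X k t == u)%:R * (X k.+1 t == v)%:R
       / w (count_mem v (H k t))
    + w 0%N * \sum_(0 <= k < n)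
        ((X k.+1 t == v')%:R / w (count_mem v' (H k t)) ^+ 2
         + (X k.+1 t == v)%:R / w (count_mem v (H k t)) ^+ 2)}.
Proof.
move=> uv w_nd.
have uvv : v = u + 1 /\ v' = u - 1 \/ v = u - 1 /\ v' = u + 1.
  by rewrite /v'; case: uv => ->; [left|right]; lia.
move: v' uvv => v' uvv.
(* The factor [w 0 / 2] brings the increments below [1 / 2]. *)
pose xi h y := w 0%N / 2 * (head 0 h == u)%:R *
  ((y == v')%:R / w (count_mem v' h) - (y == v)%:R / w (count_mem v h)) : R.
have wV n : 0 <= w 0%N * (w n)^-1 <= 1.
  by rewrite divr_ge0 ?(ltW (w_gt0 _)) // ler_pdivrMr // mul1r w_nd.
have w0 := w_gt0 0.
have vv : v != v' by apply/eqP; lia.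
have xi_le h y : `|xi h y| <= 2^-1.
  rewrite /xi; case: (head 0 h == u) => /=; last by rewrite !(mulr0, mul0r) normr0; lra.
  have := wV (count_mem v' h); have := wV (count_mem v h).
  rewrite ler_norml; have [->|_] /= := eqVneq y v'.
    by rewrite eq_sym (negbTE vv) /=; lra.
  by case: eqP => _ /=; lra.
have xi0 h : trans w h (up h) * xi h (up h) + trans w h (down h) * xi h (down h) = 0.
  rewrite /xi; case: eqP => [hu|_]; last by rewrite !(mulr0, mul0r) addr0.
  rewrite /trans hu; case: uvv vv => -[-> ->] ne.
    rewrite !eqxx (negbTE ne) eq_sym (negbTE ne) /=.
    by field; rewrite !lt0r_neq0 // addr_gt0.
  rewrite !eqxx (negbTE ne) eq_sym (negbTE ne) /=.
  by field; rewrite !lt0r_neq0 // addr_gt0.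
apply: filterS (ae_compensated xi_le xi0) => t [C SC]; exists (2 / w 0%N * C) => n.
suff le1 k : (X k t == u)%:R * (X k.+1 t == v')%:R / w (count_mem v' (H k t))
    - (X k t == u)%:R * (X k.+1 t == v)%:R / w (count_mem v (H k t))
    - w 0%N * ((X k.+1 t == v')%:R / w (count_mem v' (H k t)) ^+ 2
         + (X k.+1 t == v)%:R / w (count_mem v (H k t)) ^+ 2) <=
    2 / w 0%N * (xi (H k t) (X k.+1 t) - 2 * xi (H k t) (X k.+1 t) ^+ 2).
  rewrite -addrA -lerBlDr opprD addrA mulr_sumr -!sumrB.
  apply: (@le_trans _ _ (\sum_(0 <= k < n)
      2 / w 0%N * (xi (H k t) (X k.+1 t) - 2 * xi (H k t) (X k.+1 t) ^+ 2))).
    by apply: ler_sum => k _; exact: le1.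
  by rewrite -mulr_sumr ler_pM2l // divr_gt0.
rewrite /xi head_hist; case: (X k t == u) => /=; last first.
  rewrite !(mulr0, mul0r) expr0n /= mulr0 !subr0 mulr0 subr_le0.
  by rewrite mulr_ge0 ?(ltW w0) // addr_ge0 // divr_ge0 ?sqr_ge0 //.
rewrite !(mul1r, mulr1); set a := (w (count_mem v' _))^-1; set b := (w (count_mem v _))^-1.
have sq x : (x ^+ 2)^-1 = x^-1 ^+ 2 :> R by rewrite exprVn.
rewrite !sq -/a -/b.
have -> (y : R) : 2 / w 0%N * (w 0%N / 2 * y - 2 * (w 0%N / 2 * y) ^+ 2)
    = y - w 0%N * y ^+ 2 by field; rewrite lt0r_neq0.
have [->|_] := eqVneq (X k.+1 t) v'; last by case: eqP => _ /=; lra.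
by rewrite eq_sym (negbTE vv) /=; lra.
Qed.

(** Besides nearest neighbour steps, the bound of [ae_compensator_le] with the
    weights [c = 1] and [c = w 0 / w (Z u)], and that of [ae_inward_le_outward],
    for every pair of neighbours at once: the pairs are countable, so almost
    every trajectory is typical whichever sites it ends up visiting. *)
Definition typical (x : nat -> int) : Prop :=
  [/\ x 0%N = 0 /\ forall n, adjacent (x n) (x n.+1),
    forall u v, adjacent u v -> exists C : R, forall n,
      \sum_(0 <= k < n) (x k == u)%:R * trans w (hist x k) v <=
      C + 3 * \sum_(0 <= k < n) (x k == u)%:R * (x k.+1 == v)%:R,
    forall u v, adjacent u v -> exists C : R, forall n,
      \sum_(0 <= k < n) (x k == u)%:R * (w 0%N / w (count_mem u (hist x k)))
        * trans w (hist x k) v <=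
      C + 3 * \sum_(0 <= k < n) (x k == u)%:R * (x k.+1 == v)%:R
        * (w 0%N / w (count_mem u (hist x k))) &
    forall u v, adjacent u v -> exists C : R, forall n,
      \sum_(0 <= k < n) (x k == u)%:R * (x k.+1 == u + u - v)%:R
         / w (count_mem (u + u - v) (hist x k)) <=
      C + \sum_(0 <= k < n) (x k == u)%:R * (x k.+1 == v)%:R
         / w (count_mem v (hist x k))
      + w 0%N * \sum_(0 <= k < n)
          ((x k.+1 == u + u - v)%:R / w (count_mem (u + u - v) (hist x k)) ^+ 2
           + (x k.+1 == v)%:R / w (count_mem v (hist x k)) ^+ 2)].

Lemma ae_typical : {homo w : m n / (m <= n)%N >-> m <= n} ->
  {ae P, forall t, typical (X^~ t)}.
Proof.
move=> w_nd.
have ae_adj (Q : int -> int -> T -> Prop) :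
    (forall u v, adjacent u v -> {ae P, forall t, Q u v t}) ->
    {ae P, forall t, forall u v, adjacent u v -> Q u v t}.
  move=> QQ; suff : {ae P, forall t, forall i : int * int, adjacent i.1 i.2 -> Q i.1 i.2 t}.
    by apply: filterS => t Qt u v; exact: (Qt (u, v)).
  apply: ae_forall_countable => -[u v] /=.
  have [uv|nuv] := pselect (adjacent u v); last exact: nearW.
  by apply: filterS (QQ u v uv).
have c1 (h : seq int) : 0 <= (1 : R) <= 1 by rewrite ler01 lexx.
have cw u (h : seq int) : 0 <= w 0%N / w (count_mem u h) <= 1.
  by rewrite divr_ge0 ?(ltW (w_gt0 _)) // ler_pdivrMr // mul1r w_nd.
have X0 : forall t, X 0%N t = 0 by case: X_VRRW.
have A1 := ae_adjacent_step w_gt0 X_VRRW.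
have A2 := ae_adj _ (fun u v uv => @ae_compensator_le u v (fun=> 1) uv c1).
have A3 := ae_adj _ (fun u v uv => @ae_compensator_le u v _ uv (cw u)).
have A4 := ae_adj _ (fun u v uv => ae_inward_le_outward uv w_nd).
apply: filterS (filterI (filterI A1 A2) (filterI A3 A4)).
move=> t [[nt C1] [C2 mt]]; split=> //.
move=> u v uv; have [C le1] := C1 u v uv; exists C => n.
have := le1 n; under eq_bigr do rewrite mulr1.
by under [X in _ + 3 * X]eq_bigr do rewrite mulr1.
Qed.

End Compensation.

(** * Local times along a typical trajectory *)

Section Path.
Context (R : realType) (w : nat -> R) (w_gt0 : forall n, 0 < w n).
Context (w_nd : {homo w : m n / (m <= n)%N >-> m <= n}).
Context (x : nat -> int) (x_typ : typical w x).

Local Notation Z n y := (count_mem y (hist x n)).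

Definition Wsum (n : nat) : R := \sum_(0 <= i < n) (w i)^-1.

Let w0 : 0 < w 0%N. Proof. exact: w_gt0. Qed.

Let winv_ge0 n : 0 <= (w n)^-1. Proof. by rewrite invr_ge0 ltW. Qed.

Let winv_le m n : (m <= n)%N -> (w n)^-1 <= (w m)^-1.
Proof. by move=> mn; rewrite lef_pV2 ?posrE // w_nd. Qed.

Lemma le_Wsum m n : (m <= n)%N -> Wsum m <= Wsum n.
Proof.
move=> mn; rewrite /Wsum (big_cat_nat (leq0n m) mn) /= lerDl.
by rewrite sumr_ge0.
Qed.

Lemma Wsum_ge0 n : 0 <= Wsum n.
Proof. by rewrite sumr_ge0. Qed.

Lemma ZS n y : Z n.+1 y = ((x n.+1 == y) + Z n y)%N.
Proof. by []. Qed.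

Lemma x_adjacent n : adjacent (x n) (x n.+1).
Proof. by case: x_typ => [[_ /(_ n)]]. Qed.

Lemma entry_sum (f : nat -> R) y n :
  \sum_(0 <= k < n) (x k.+1 == y)%:R * f (Z k y) =
  \sum_(Z 0 y <= j < Z n y) f j.
Proof.
elim: n => [|n IH]; first by rewrite !big_geq.
rewrite big_nat_recr //= IH; case: (x n.+1 == y) => /=.
  by rewrite add1n big_nat_recr /= ?mul1r // (count_hist_le x y (leq0n n)).
by rewrite mul0r addr0 add0n.
Qed.

Lemma entry_sum_le (f : nat -> R) y n : (forall j, 0 <= f j) ->
  \sum_(0 <= k < n) (x k.+1 == y)%:R * f (Z k y) <= \sum_(0 <= j < Z n y) f j.
Proof.
move=> f0; rewrite entry_sum (@big_cat_nat _ _ _ (Z 0 y) 0 (Z n y)) //=.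
  by rewrite lerDr sumr_ge0.
exact: (count_hist_le x y (leq0n n)).
Qed.

Lemma Wsum_le_entries (y : int) n : Wsum (Z n y) <=
  (w 0%N)^-1 + \sum_(0 <= k < n) (x k.+1 == y)%:R / w (Z k y).
Proof.
rewrite (@entry_sum (fun j => (w j)^-1)) /Wsum.
rewrite (@big_cat_nat _ _ _ (Z 0 y) 0 (Z n y)) //=; last exact: (count_hist_le x y (leq0n n)).
rewrite lerD2r; have : (Z 0 y <= 1)%N by rewrite /= addn0 leq_b1.
move=> /=; case: (_ + _)%N => [|[|//]] _; first by rewrite big_geq.
by rewrite big_nat1.
Qed.

(** Every level [j] of the larger of two local times is reached during a visit
    to the site that has the larger local time at that moment. *)
Lemma max_sum (f : nat -> R) u v n : (forall j, 0 <= f j) -> u != v ->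
  \sum_(1 <= j < (maxn (Z n u) (Z n v)).+1) f j <=
  \sum_(0 <= k < n.+1)
    ((x k == u)%:R * (Z k v <= Z k u)%N%:R * f (Z k u) +
     (x k == v)%:R * (Z k u <= Z k v)%N%:R * f (Z k v)).
Proof.
move=> f0 uv; elim: n => [|n IH].
  rewrite big_nat1 /=; have [->|xu] /= := eqVneq (x 0%N) u.
    by rewrite (negbTE uv) /= big_nat1 !mul1r mul0r mul0r addr0.
  have [_|_] /= := eqVneq (x 0%N) v.
    by rewrite big_nat1 !mul1r !mul0r add0r.
  by rewrite big_geq // !mul0r addr0.
rewrite [leRHS]big_nat_recr //=.
have rhs_ge0 (a b : bool) m : 0 <= a%:R * b%:R * f m.
  by rewrite mulr_ge0 // mulr_ge0 // ler0n.
have [xu|xu] := eqVneq (x n.+1) u.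
  rewrite -xu in uv IH *; rewrite (negbTE uv) /= add0n add1n !mul0r addr0 mul1r.
  case: (leqP (Z n v) (Z n (x n.+1))) => zz.
    rewrite (maxn_idPl _); last exact: leqW.
    rewrite (leqW zz) mul1r big_nat_recr //= lerD2r.
    by rewrite (maxn_idPl zz) in IH.
  rewrite (maxn_idPr zz); rewrite (maxn_idPr (ltnW zz)) in IH.
  by rewrite (le_trans IH) // lerDl mulr_ge0 ?ler0n.
have [xv|xv] := eqVneq (x n.+1) v.
  rewrite -xv in uv IH *; rewrite /= add0n add1n !mul0r add0r mul1r.
  case: (leqP (Z n u) (Z n (x n.+1))) => zz.
    rewrite (maxn_idPr _); last exact: leqW.
    rewrite (leqW zz) mul1r big_nat_recr //= lerD2r.
    by rewrite (maxn_idPr zz) in IH.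
  rewrite (maxn_idPl zz); rewrite (maxn_idPl (ltnW zz)) in IH.
  by rewrite (le_trans IH) // lerDl mulr_ge0 ?ler0n.
by rewrite !add0n !mul0r !addr0.
Qed.

(** Each visit to [y], except possibly the current one, is followed by a visit to
    a neighbour. *)
Lemma Z_le_nbrs n (y : int) :
  (Z n y <= Z n (y + 1)%R + Z n (y - 1)%R + (x n == y))%N.
Proof.
elim: n => [|n IH]; first by rewrite /= addn0 leq_addl.
have le1 : ((x n == y) <= (x n.+1 == (y + 1)%R) + (x n.+1 == (y - 1)%R))%N.
  have [xy|//] := eqVneq (x n) y.
  by have := x_adjacent n; rewrite /adjacent xy => -[] ->; rewrite eqxx ?addn1.
rewrite !ZS; move: le1 IH; do 3 move: (count _ _) => ?.
by do 4 case: (_ == _) => /=; lia.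
Qed.

Lemma transE h v : adjacent (head 0 h) v -> trans w h v =
  w (count_mem v h) / (w (count_mem v h) + w (count_mem (head 0 h + head 0 h - v) h)).
Proof.
rewrite /trans; move: (head 0 h) => z -[] ->.
  by have -> : z + z - (z + 1) = z - 1 by ring.
have -> : z + z - (z - 1) = z + 1 by ring.
by rewrite [X in _ / X]addrC.
Qed.

Lemma trans_ge h v : adjacent (head 0 h) v ->
  w 0%N / 2 / w (count_mem (head 0 h + head 0 h - v) h) <= trans w h v.
Proof.
move=> hv; rewrite transE //; move: (count_mem v h) (count_mem (_ - _) h) => m n.
rewrite ler_pdivlMr ?addr_gt0 // mulrAC ler_pdivrMr //.
have := w_nd (leq0n m); have := w_nd (leq0n n); have := w_gt0 m; have := w_gt0 n.
nra.
Qed.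

Lemma departures_le (u : int) n : (\sum_(0 <= k < n) (x k == u) <= Z n u)%N.
Proof.
apply: leq_trans (_ : \sum_(0 <= k < n.+1) (x k == u) <= _)%N.
  by rewrite big_nat_recr //= leq_addr.
elim: n => [|n IH]; first by rewrite big_nat1 /= addn0.
by rewrite big_nat_recr //= addnC leq_add2l.
Qed.

Section Outward.
(** One side of the center [a]: [e] is the outward unit step. *)
Variables (a e : int) (he : e = 1 \/ e = -1).
Local Notation p := (a + e).
Local Notation q := (a + e + e).
Local Notation r := (a + e + e + e).

Let adj_p : adjacent p q. Proof. by case: he => ->; [left|right]. Qed.
Let adj_q : adjacent q r. Proof. by case: he => ->; [left|right]. Qed.
Let ppq : p + p - q = a. Proof. by ring. Qed.
Let qqr : q + q - r = p. Proof. by ring. Qed.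
Let pq : p != q. Proof. by apply/eqP; case: he => ->; lia. Qed.

(** A site next to a finitely visited site [r] is left towards [r] finitely
    often, so the conditional probabilities of doing so are summable. *)
Lemma summable_far_visits (B : nat) : (forall n, Z n r <= B)%N ->
  exists C : R, forall n,
    \sum_(0 <= k < n) (x k == q)%:R / w (Z k p) <= C.
Proof.
move=> ZB; have [_ /(_ q r adj_q)[C le1] _ _] := x_typ.
exists (2 / w 0%N * (C + 3 * B%:R)) => n.
have le2 : \sum_(0 <= k < n) (x k == q)%:R * (x k.+1 == r)%:R <= B%:R :> R.
  apply: (@le_trans _ _ (\sum_(0 <= k < n) (x k.+1 == r)%:R * 1)).
    by apply: ler_sum => k _; rewrite mulr1 ler_piMl ?ler0n // lern1 leq_b1.
  apply: (le_trans (@entry_sum_le (fun=> 1) r n _)) => [//|].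
  by rewrite big_const_nat subn0 iter_addr_0 ler_nat.
have w20 : 0 < 2 / w 0%N by rewrite divr_gt0.
rewrite mulrC -ler_pdivrMr // mulr_suml.
apply: (@le_trans _ _ (\sum_(0 <= k < n) (x k == q)%:R * trans w (hist x k) r)).
  apply: ler_sum => k _; case: eqP => [xq|_]; last by rewrite !mul0r.
  rewrite !mul1r invf_div mulrC.
  have := @trans_ge (hist x k) r; rewrite head_hist xq qqr; exact.
by apply: (le_trans (le1 n)); rewrite lerD2l ler_pM2l.
Qed.

(** Departures from [p] towards [q], weighted by [1 / w (Z p)], are summable by
    [summable_far_visits]; hence so are their conditional expectations. *)
Lemma summable_near_visits (B : nat) : (forall n, Z n r <= B)%N ->
  exists C : R, forall n,
    \sum_(0 <= k < n) (x k == p)%:R / (w (Z k a) * w (Z k p)) <= C.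
Proof.
move=> /summable_far_visits[C2 le2]; have [_ _ /(_ p q adj_p)[C le1] _] := x_typ.
exists (2 / w 0%N ^+ 2 * (C + 3 * (w 0%N * C2))) => n.
have le3 : \sum_(0 <= k < n) (x k == p)%:R * (x k.+1 == q)%:R * (w 0%N / w (Z k p))
    <= w 0%N * C2.
  apply: (@le_trans _ _ (\sum_(0 <= k < n) w 0%N * ((x k.+1 == q)%:R / w (Z k.+1 p)))).
    apply: ler_sum => k _; case: (x k == p) => /=; last first.
      by rewrite !mul0r mulr_ge0 ?(ltW w0) // mulr_ge0.
    case: eqP => [->|_]; last by rewrite !(mul0r, mulr0).
    by rewrite eq_sym (negbTE pq) add0n !mul1r.
  rewrite -mulr_sumr ler_pM2l //; apply: le_trans (le2 n.+1).
  by rewrite [leRHS]big_nat_recl // lerDr mulr_ge0.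
have w20 : 0 < 2 / w 0%N ^+ 2 by rewrite divr_gt0 // exprn_gt0.
rewrite mulrC -ler_pdivrMr // mulr_suml.
apply: (@le_trans _ _ (\sum_(0 <= k < n)
    (x k == p)%:R * (w 0%N / w (Z k p)) * trans w (hist x k) q)).
  apply: ler_sum => k _; case: eqP => [xp|_]; last by rewrite !mul0r.
  have := @trans_ge (hist x k) q; rewrite head_hist xp ppq => /(_ adj_p) tge.
  have c0 : 0 <= w 0%N / w (Z k p) by rewrite divr_ge0 // ltW.
  rewrite !mul1r; apply: le_trans (ler_wpM2l c0 tge).
  by rewrite le_eqVlt; apply/orP; left; apply/eqP; field; rewrite !lt0r_neq0.
by apply: (le_trans (le1 n)); rewrite lerD2l ler_pM2l.
Qed.

(** The martingale bound at [p]: its quadratic variation is at most a sum of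
    [1 / w j ^ 2] over the levels of [Z a] and of [Z q]. *)
Lemma inward_entries_le (D : R) : (forall n, \sum_(0 <= j < n) (w j)^-1 ^+ 2 <= D) ->
  exists C : R, forall n,
    \sum_(0 <= k < n) (x k == p)%:R * (x k.+1 == a)%:R / w (Z k a) <=
    C + Wsum (Z n q).
Proof.
move=> wD; have [_ _ _ /(_ p q adj_p)[C]] := x_typ; rewrite ppq => le1.
exists (C + w 0%N * (D + D)) => n; apply: (le_trans (le1 n)).
have sq y : \sum_(0 <= k < n) (x k.+1 == y)%:R / w (Z k y) ^+ 2 <= D.
  under eq_bigr do rewrite -exprVn.
  by apply: (le_trans (@entry_sum_le (fun j => (w j)^-1 ^+ 2) y n _)) => // j; exact: sqr_ge0.
have le2 : \sum_(0 <= k < n) (x k == p)%:R * (x k.+1 == q)%:R / w (Z k q) <= Wsum (Z n q).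
  apply: le_trans (@entry_sum_le (fun j => (w j)^-1) q n _) => //.
  apply: ler_sum => k _; rewrite -mulrA ler_piMl ?lern1 ?leq_b1 //.
  by rewrite mulr_ge0.
rewrite big_split /=; have := lerD (sq a) (sq q).
rewrite -(ler_pM2l w0); lra.
Qed.

(** Entries to [p] from [q] contribute a bounded amount to [Wsum (Z p)] by
    [summable_far_visits]; entries from [a] contribute at most [Wsum] of their
    number, since [w] is nondecreasing. *)
Lemma Wsum_near_le (B : nat) : (forall n, Z n r <= B)%N ->
  exists C : R, forall n, Wsum (Z n p) <= C + Wsum (Z n a).
Proof.
move=> /summable_far_visits[C2 le2]; exists ((w 0%N)^-1 + C2) => n.
pose N m := (\sum_(0 <= k < m) ((x k == a) && (x k.+1 == p)))%N.
have NZa m : (N m <= Z m a)%N.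
  apply: leq_trans (departures_le a m); apply: leq_sum => k _.
  by case: (x k == a); rewrite //= leq_b1.
have NZp m : (N m <= Z m p)%N.
  elim: m => [|m IH]; first by rewrite /N big_geq.
  rewrite /N big_nat_recr //= -/(N m) [leqLHS]addnC.
  by apply: leq_add => //; case: (x m == a) => /=.
have from_a m : \sum_(0 <= k < m) ((x k == a) && (x k.+1 == p))%:R / w (Z k p) <= Wsum (N m).
  elim: m => [|m IH]; first by rewrite /N !big_geq // /Wsum big_geq.
  rewrite /N !big_nat_recr //= -/(N m).
  case: (_ && _); last by rewrite addn0 mul0r addr0.
  by rewrite addn1 /Wsum big_nat_recr //= lerD // mul1r winv_le.
apply: (le_trans (Wsum_le_entries p n)); rewrite -addrA lerD2l.
apply: (@le_trans _ _ (\sum_(0 <= k < n) ((x k == q)%:R / w (Z k p) +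
    ((x k == a) && (x k.+1 == p))%:R / w (Z k p)))).
  apply: ler_sum => k _; rewrite -mulrDl; apply: ler_wpM2r => //.
  rewrite -natrD ler_nat; case: eqP => //= xp; rewrite andbT.
  have := x_adjacent k; rewrite /adjacent xp => xk.
  by do 2 case: eqP => //; case: he xk => -> [] ?; lia.
rewrite big_split lerD //; apply: (le_trans (from_a n)); exact: le_Wsum.
Qed.

End Outward.

Section Center.
Variables (a : int) (B : nat).
Hypotheses (ZBr : forall n, (Z n (a + 1 + 1 + 1)%R <= B)%N)
  (ZBl : forall n, (Z n (a - 1 - 1 - 1)%R <= B)%N)
  (Zinf : forall N, exists n, (N <= Z n (a - 1 - 1)%R)%N).

Let er : (1 : int) = 1 \/ (1 : int) = -1. Proof. by left. Qed.
Let el : (-1 : int) = 1 \/ (-1 : int) = -1. Proof. by right. Qed.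

(** Inspect the levels [j] of [max (Z (a + 1), Z (a - 1))]: when level [j] is
    reached, [Z a] is at most [2 * j], so that the sums of [summable_near_visits]
    dominate the sum of the [1 / w (2 * j + 1) ^ 2]. *)
Lemma summable_winv2_odd : exists C : R, forall M,
  \sum_(1 <= j < M) (w j.*2.+1)^-1 ^+ 2 <= C.
Proof.
have [Cr le_r] := summable_near_visits er ZBr; have [Cl le_l] := summable_near_visits el ZBl.
exists (Cr + Cl) => M.
have [n ZM] : exists n, (M <= (maxn (Z n (a + 1)%R) (Z n (a - 1)%R)).+1)%N.
  have [n Zn] := Zinf (M + B + 1)%N; exists n.
  have := Z_le_nbrs n (a - 1 - 1)%R; have := ZBl n.
  have -> : a - 1 - 1 + 1 = a - 1 by ring.
  move: Zn; do 4 move: (count _ _) => ?; case: (_ == _) => /=; lia.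
apply: (@le_trans _ _ (\sum_(1 <= j < (maxn (Z n (a + 1)%R) (Z n (a - 1)%R)).+1)
    (w j.*2.+1)^-1 ^+ 2)).
  have [M1|M1] := leqP M 1; first by rewrite big_geq // sumr_ge0 // => i _; exact: sqr_ge0.
  rewrite (big_cat_nat (ltnW M1) ZM) /= lerDl sumr_ge0 // => i _; exact: sqr_ge0.
apply: le_trans (@max_sum (fun j => (w j.*2.+1)^-1 ^+ 2) _ _ _ _ _) _.
- by move=> j; exact: sqr_ge0.
- by apply/eqP; lia.
apply: le_trans (lerD (le_r n.+1) (le_l n.+1)).
rewrite -big_split /=; apply: ler_sum => k _.
have nb := Z_le_nbrs k a.
have key u v : u != a -> (Z k a <= Z k u + Z k v + (x k == a))%N ->
    (x k == u)%:R * (Z k v <= Z k u)%N%:R * (w (Z k u).*2.+1)^-1 ^+ 2 <=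
    (x k == u)%:R / (w (Z k a) * w (Z k u)).
  move=> ua; have [xu|_] := eqVneq (x k) u; last by rewrite !mul0r.
  rewrite xu (negbTE ua) addn0 => Za.
  have pos : 0 <= (w (Z k a) * w (Z k u))^-1 by rewrite invfM mulr_ge0.
  case: leqP => vu; last by rewrite /= mulr0 mul0r mul1r.
  rewrite !mul1r invfM expr2; apply: ler_pM => //; apply: winv_le; lia.
apply: lerD; apply: key; try by apply/eqP; lia.
  exact: nb.
by rewrite [X in (_ <= X + _)%N]addnC; exact: nb.
Qed.

(** Since [w] is nondecreasing, the odd indices control the even ones. *)
Lemma summable_winv2 : exists D : R, forall n, \sum_(0 <= j < n) (w j)^-1 ^+ 2 <= D.
Proof.
have [C leC] := summable_winv2_odd; exists (3 * (w 0%N)^-1 ^+ 2 + 2 * C) => n.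
have sq0 j : 0 <= (w j)^-1 ^+ 2 by exact: sqr_ge0.
have sqle i j : (i <= j)%N -> (w j)^-1 ^+ 2 <= (w i)^-1 ^+ 2.
  by move=> ij; rewrite !expr2 ler_pM // winv_le.
suff main M : \sum_(0 <= j < M.*2.+3) (w j)^-1 ^+ 2 <= 3 * (w 0%N)^-1 ^+ 2 +
    2 * \sum_(1 <= j < M.+1) (w j.*2.+1)^-1 ^+ 2.
  have nn3 : (n <= n.*2.+3)%N by lia.
  apply: (@le_trans _ _ (\sum_(0 <= j < n.*2.+3) (w j)^-1 ^+ 2)).
    by rewrite (big_cat_nat (leq0n n) nn3) /= lerDl sumr_ge0.
  by apply: (le_trans (main n)); rewrite lerD2l ler_pM2l.
elim: M => [|M IH].
  rewrite (@big_geq _ _ _ 1 1) // mulr0 addr0 !big_nat_recr //= big_geq // add0r.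
  by have := sqle 0%N 1%N isT; have := sqle 0%N 2%N isT; lra.
rewrite doubleS [leRHS]/= big_nat_recr //= big_nat_recr //=.
rewrite [X in _ <= _ + 2 * X]big_nat_recr //=.
have := sqle M.*2.+3 M.*2.+4 (leqnSn _); rewrite doubleS; lra.
Qed.

(** Sum [inward_entries_le] over the two sides. *)
Lemma Wsum_center_le : exists C : R, forall n,
  Wsum (Z n a) <= C + (Wsum (Z n (a + 1 + 1)%R) + Wsum (Z n (a - 1 - 1)%R)).
Proof.
have [D wD] := summable_winv2.
have [Cr le_r] := inward_entries_le a er wD; have [Cl le_l] := inward_entries_le a el wD.
exists ((w 0%N)^-1 + (Cr + Cl)) => n.
apply: (le_trans (Wsum_le_entries a n)); rewrite -addrA lerD2l addrACA.
apply: le_trans (lerD (le_r n) (le_l n)); rewrite -big_split /=.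
apply: ler_sum => k _; rewrite -mulrDl; apply: ler_wpM2r => //.
have [xa|_] := eqVneq (x k.+1) a; last by rewrite !mulr0 addr0.
rewrite !mulr1 -natrD ler_nat.
have := x_adjacent k; rewrite /adjacent xa => -[] xk.
  by rewrite (_ : x k == a - 1) ?addn1 //; apply/eqP; lia.
by rewrite (_ : x k == a + 1) //; apply/eqP; lia.
Qed.

(** When [Z (a + 2)], say, reaches a level [j] at which it is the larger of
    [Z (a + 2)] and [Z (a - 2)], the bounds on [Wsum] give
    [Wsum (Z (a + 1)) <= 2 * Wsum j + beta]; the factor [2] comes from bounding
    the smaller outer local time by the larger one. Then [f j] is dominated by
    the term of [summable_far_visits] for that visit. *)
Lemma summable_levels : exists beta : R, 0 <= beta /\ exists C : R, forall f : nat -> R,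
  (forall j, 0 <= f j) ->
  (forall j m, Wsum m <= 2 * Wsum j + beta -> f j <= (w m)^-1) ->
  forall M, \sum_(1 <= j < M) f j <= C.
Proof.
have [C0 leC0] := Wsum_center_le.
have [C1r leC1r] := Wsum_near_le er ZBr; have [C1l leC1l] := Wsum_near_le el ZBl.
have [Cr le_r] := summable_far_visits er ZBr; have [Cl le_l] := summable_far_visits el ZBl.
exists (`|C0| + `|C1r| + `|C1l|); split; first by rewrite !addr_ge0.
exists (Cr + Cl) => f f0 fle M.
have [n Zn] := Zinf M.
have ZM : (M <= (maxn (Z n (a + 1 + 1)%R) (Z n (a - 1 - 1)%R)).+1)%N.
  by apply: (leq_trans Zn); rewrite ltnW // ltnS leq_maxr.
apply: (@le_trans _ _
    (\sum_(1 <= j < (maxn (Z n (a + 1 + 1)%R) (Z n (a - 1 - 1)%R)).+1) f j)).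
  have [M1|M1] := leqP M 1; first by rewrite big_geq // sumr_ge0.
  by rewrite (big_cat_nat (ltnW M1) ZM) /= lerDl sumr_ge0.
apply: le_trans (@max_sum f _ _ _ _ _) _ => //; first by apply/eqP; lia.
apply: le_trans (lerD (le_r n.+1) (le_l n.+1)).
rewrite -big_split /=; apply: ler_sum => k _.
have key u v s C1 : C1 <= `|C1r| + `|C1l| -> Wsum (Z k s) <= C1 + Wsum (Z k a) ->
    Wsum (Z k a) <= C0 + (Wsum (Z k u) + Wsum (Z k v)) ->
    (x k == u)%:R * (Z k v <= Z k u)%N%:R * f (Z k u) <= (x k == u)%:R / w (Z k s).
  move=> C1le le1 le2; case: (x k == u); last by rewrite !mul0r.
  case: leqP => vu; last by rewrite /= mulr0 mul0r mul1r.
  rewrite !mul1r; apply: fle; have := le_Wsum vu; have := ler_norm C0; lra.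
have := ler_norm C1r; have := ler_norm C1l.
have := normr_ge0 C1r; have := normr_ge0 C1l => ? ? ? ?.
apply: lerD.
- by apply: (key _ _ _ C1r); [lra|exact: leC1r|exact: leC0].
- by apply: (key _ _ _ C1l); [lra|exact: leC1l|rewrite [X in C0 + X]addrC; exact: leC0].
Qed.

End Center.

End Path.

(** * From sums over levels to the critical parameter *)

Section Weight.
Context (R : realType) (w : nat -> R) (w_gt0 : forall n, 0 < w n).
Context (w_nd : {homo w : m n / (m <= n)%N >-> m <= n}).
Context (w_div : (\sum_(0 <= n <oo) ((w n)^-1)%:E = +oo)%E).

Local Notation mu := (@lebesgue_measure R).
Local Notation g u := ((wext w u)^-1).

Lemma Wsum_unbounded (K : R) : exists n, K <= Wsum w n.
Proof.
apply: contrapT => /forallNP nK.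
suff : (\sum_(0 <= n <oo) ((w n)^-1)%:E <= K%:E)%E by rewrite w_div leye_eq.
apply: lime_le.
  by apply: is_cvg_nneseries => n _ _; rewrite lee_fin invr_ge0 ltW.
apply: nearW => n; rewrite sumEFin lee_fin ltW // ltNge.
exact/negP/nK.
Qed.

Lemma nonincreasing_measurable (D : set R) (f : R -> R) : measurable D ->
  {homo f : s t / s <= t >-> t <= s} -> measurable_fun D f.
Proof.
move=> mD f_ni; rewrite (_ : f = (fun t => - (- f t))); last first.
  by apply/funext => t; rewrite opprK.
apply: measurable_funN; apply: nondecreasing_measurable => // s t st.
by rewrite lerN2 f_ni.
Qed.

Lemma wextV_le : {homo (fun u => g u) : s t / s <= t >-> t <= s}.
Proof.
move=> s t st; rewrite /wext lef_pV2 ?posrE //; apply: w_nd; exact: le_truncn.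
Qed.

Lemma wextV_gt0 u : 0 < g u. Proof. by rewrite invr_gt0 w_gt0. Qed.

Lemma integrable_wextV (i : interval R) : (mu [set` i] < +oo)%E ->
  mu.-integrable [set` i] (EFin \o (fun u => g u)).
Proof.
move=> fin; apply: measurable_bounded_integrable => //.
  by apply: nonincreasing_measurable => //; exact: wextV_le.
exists (w 0%N)^-1; split; first by rewrite num_real.
move=> M wM u _ /=; rewrite ger0_norm ?(ltW (wextV_gt0 u)) // (le_trans _ (ltW wM)) //.
by rewrite /wext lef_pV2 ?posrE //; exact: w_nd.
Qed.

Let itv_fin (a b : R) (bl br : bool) :
  (mu [set` Interval (BSide bl a) (BSide br b)] < +oo)%E.
Proof. by rewrite lebesgue_measure_itv /=; case: ifP => //; rewrite -EFinB ltry. Qed.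

Lemma Rintegral_cst_itv (r s t : R) (bl br : bool) : s < t ->
  \int[mu]_(u in [set` Interval (BSide bl s) (BSide br t)]) r = r * (t - s).
Proof.
move=> st; rewrite Rintegral_cst //; congr (_ * _).
transitivity (fine (mu [set` Interval (BSide bl s) (BSide br t)])) => //.
by rewrite lebesgue_measure_itv /= lte_fin st.
Qed.

Lemma bigW_diff s t : 0 <= s -> s <= t ->
  bigW w t - bigW w s = \int[mu]_(u in `]s, t]) g u.
Proof.
move=> s0 st; apply: Rintegral_itvB; rewrite ?bnd_simp //.
exact: integrable_wextV.
Qed.

Lemma bigW_lt0 t : t < 0 -> bigW w t = 0.
Proof. by move=> t0; rewrite /bigW set_itv_ge ?bnd_simp -?ltNge // Rintegral_set0. Qed.

Lemma bigW0 : bigW w 0 = 0.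
Proof. by rewrite /bigW set_itv1 Rintegral_set1. Qed.

Lemma bigW_lt s t : 0 <= s -> s < t -> bigW w s < bigW w t.
Proof.
move=> s0 st; rewrite -subr_gt0 bigW_diff ?(ltW st) //.
apply: (@lt_le_trans _ _ (\int[mu]_(u in `]s, t]) g t)).
  rewrite Rintegral_cst_itv //.
  by rewrite mulr_gt0 ?wextV_gt0 // subr_gt0.
apply: le_Rintegral => //.
- apply: measurable_bounded_integrable => //; first exact: itv_fin.
  exists `|g t|; split; first by rewrite num_real.
  by move=> M /ltW gM u _.
- exact: integrable_wextV.
- by move=> u /=; rewrite in_itv /= => /andP[_]; exact: wextV_le.
Qed.

Lemma bigW_ge0 t : 0 <= bigW w t.
Proof. by apply: Rintegral_ge0 => u _; rewrite ltW // wextV_gt0. Qed.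

(** Monotone on the whole line, as [bigW] vanishes at negative arguments; so
    [nonincreasing_measurable] applies to the integrand of [Jbeta]. *)
Lemma bigW_le : {homo bigW w : s t / s <= t}.
Proof.
move=> s t; rewrite le_eqVlt => /orP[/eqP -> //|st].
have [s0|s0] := leP 0 s; first by rewrite ltW // bigW_lt.
by rewrite (bigW_lt0 s0) bigW_ge0.
Qed.

Lemma bigW_nat n : bigW w n%:R = Wsum w n.
Proof.
elim: n => [|n IH]; first by rewrite bigW0 /Wsum big_geq.
apply/eqP; rewrite /Wsum big_nat_recr //= -/(Wsum w n) -IH addrC -subr_eq.
rewrite bigW_diff ?ler0n ?ler_nat // -Rintegral_itv_bndo_bndc; last exact: integrable_wextV.
rewrite (@eq_Rintegral _ _ _ _ _ (fun=> (w n)^-1)).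
  rewrite Rintegral_cst_itv ?ltr_nat //.
  by rewrite -natrB // subSnn mulr1.
move=> u; rewrite inE /= in_itv /= => /andP[nu un].
by rewrite /wext (@truncn_def _ _ n) // (ltW nu).
Qed.

Lemma bigW_surj u : 0 <= u -> exists2 t, 0 <= t & bigW w t = u.
Proof.
move=> u0; have [n un] := Wsum_unbounded u; rewrite -bigW_nat in un.
have n0 : 0 <= n%:R :> R by [].
have [] := @IVT R (bigW w) 0 n%:R u n0.
- apply: parameterized_integral_continuous => //; exact: integrable_wextV.
- by rewrite bigW0 (min_idPl _) ?bigW_ge0 // (max_idPr _) ?bigW_ge0 // u0.
- by move=> t; rewrite in_itv /= => /andP[t0 _] <-; exists t.
Qed.

Lemma bigWK t : 0 <= t -> bigW_inv w (bigW w t) = t.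
Proof.
move=> t0; rewrite /bigW_inv ltNge bigW_ge0 /=; apply: pinvKV; last first.
  by rewrite inE /= in_itv /= t0.
move=> r s; rewrite !inE /= !in_itv /= !andbT => r0 s0 rs.
apply/eqP; rewrite eq_le !leNgt; apply/andP; split; apply/negP => lt_rs.
  by have := bigW_lt s0 lt_rs; rewrite rs ltxx.
by have := bigW_lt r0 lt_rs; rewrite rs ltxx.
Qed.

Lemma bigW_inv_le u v : 0 <= u -> u <= v -> bigW_inv w u <= bigW_inv w v.
Proof.
move=> u0 uv; have [s s0 Ws] := bigW_surj u0.
have [t t0 Wt] := bigW_surj (le_trans u0 uv).
rewrite -Ws -Wt !bigWK // leNgt; apply/negP => ts.
by have := bigW_lt t0 ts; rewrite Ws Wt ltNge uv.
Qed.

(** The integrand of [Jbeta w beta] at the integer [j], since [bigW w j%:R] is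
    [Wsum w j]. *)
Definition levelV (beta : R) (j : nat) : R := g (bigW_inv w (2 * Wsum w j + beta)).

Lemma levelV_le beta j m : Wsum w m <= 2 * Wsum w j + beta -> levelV beta j <= (w m)^-1.
Proof.
move=> le1; have -> : w m = wext w m%:R by rewrite /wext natrK.
apply: wextV_le.
rewrite -(bigWK (ler0n _ m)) bigW_nat; apply: bigW_inv_le le1.
exact: Wsum_ge0.
Qed.

(** The integrand is nonincreasing, hence at most its value at the integer part
    of the argument. *)
Lemma Jbeta_le beta : 0 <= beta ->
  (Jbeta w beta <= \sum_(0 <= j <oo) (levelV beta j)%:E)%E.
Proof.
move=> beta0; pose h (t : R) := levelV beta (Num.truncn t).
have arg_ge0 t : 0 <= 2 * bigW w t + beta by rewrite addr_ge0 // mulr_ge0 // bigW_ge0.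
have argn_ge0 j : 0 <= 2 * Wsum w j + beta by rewrite -bigW_nat.
have mG D : measurable D ->
    measurable_fun D (fun t : R => g (bigW_inv w (2 * bigW w t + beta))).
  move=> mD; apply: nonincreasing_measurable => // s t st.
  by apply: wextV_le; apply: bigW_inv_le => //; rewrite lerD2r ler_pM2l // bigW_le.
have mh D : measurable D -> measurable_fun D h.
  move=> mD; apply: nonincreasing_measurable => // s t st.
  apply: wextV_le; apply: bigW_inv_le => //; rewrite lerD2r ler_pM2l //.
  by rewrite -!bigW_nat bigW_le // ler_nat le_truncn.
apply: (@le_trans _ _ (\int[mu]_(t in `[0%R, +oo[) (h t)%:E)%E).
  apply: ge0_le_integral => //.
  - by move=> t _; rewrite lee_fin ltW // wextV_gt0.
  - by apply/measurable_EFinP; exact: mG.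
  - by apply/measurable_EFinP; exact: mh.
  - move=> t; rewrite /= in_itv /= andbT => t0; rewrite lee_fin.
    apply: wextV_le; apply: bigW_inv_le => //; rewrite lerD2r ler_pM2l //.
    by rewrite -bigW_nat bigW_le // truncn_le.
have -> : `[0%R, +oo[%classic = \bigcup_n `[n%:R, n.+1%:R[%classic :> set R.
  apply/seteqP; split=> t /=; rewrite in_itv /= ?andbT.
    by move=> t0; exists (Num.truncn t); rewrite //= in_itv /= truncn_itv.
  by move=> [n _] /=; rewrite in_itv /= => /andP[nt _]; exact: le_trans nt.
rewrite ge0_integral_bigcup //.
- apply: lee_nneseries => n.
    by move=> _ _; apply: integral_ge0 => t _; rewrite lee_fin ltW // wextV_gt0.
  move=> _; rewrite (eq_integral (cst (levelV beta n)%:E)); last first.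
    by move=> t; rewrite inE /= in_itv /= => nt; rewrite /h (truncn_def nt).
  rewrite integral_cst //.
  apply: (@le_trans _ _ ((levelV beta n)%:E * mu `[n%:R, n.+1%:R[%classic)%E) => //.
  rewrite lebesgue_measure_itv /= lte_fin ltr_nat ltnS leqnn.
  by rewrite -EFinB -natrB // subSnn mule1.
- apply/measurable_EFinP; apply: mh; exact: bigcupT_measurable.
- by move=> t _; rewrite lee_fin ltW // wextV_gt0.
- apply/trivIsetP => m n _ _ mn; apply/seteqP; split=> t //= [].
  rewrite !in_itv /= => mt nt; move/eqP: mn; apply.
  by rewrite -(truncn_def mt) -(truncn_def nt).
Qed.

Lemma beta_c_lt_oo beta C : 0 <= beta ->
  (forall M, \sum_(1 <= j < M) levelV beta j <= C) -> (beta_c w < +oo)%E.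
Proof.
move=> beta0 leC; apply: (@le_lt_trans _ _ beta%:E); last exact: ltry.
apply: ereal_inf_lbound; exists beta => //=.
apply: (le_lt_trans (Jbeta_le beta0)).
apply: (@le_lt_trans _ _ (levelV beta 0 + C)%:E); last exact: ltry.
apply: lime_le.
  by apply: is_cvg_nneseries => n _ _; rewrite lee_fin ltW // wextV_gt0.
apply: nearW => -[|n].
  have p0 : 0 <= levelV beta 0 by rewrite ltW // wextV_gt0.
  by rewrite big_geq // lee_fin addr_ge0 // (le_trans _ (leC 0%N)) // big_geq.
by rewrite sumEFin lee_fin big_ltn // lerD2l leC.
Qed.

End Weight.

(** * The set of infinitely visited sites *)

Section InfinitelyVisited.
Context (x : nat -> int) (x_adj : forall n, adjacent (x n) (x n.+1)).

Local Notation Z n y := (count_mem y (hist x n)).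

Definition recurrent (y : int) : Prop := forall N, exists n, (N <= Z n y)%N.

Lemma recurrentP y : recurrent y <-> forall n, exists2 k, (n <= k)%N & x k = y.
Proof.
split=> [rec n|vis].
  apply: contrapT => nk; have [m] := rec (Z n y).+1; apply/negP; rewrite -ltnNge ltnS.
  have [mn|/ltnW nm] := leqP m n; first exact: count_hist_le.
  rewrite -(subnKC nm); elim: (m - n)%N => [|k IH]; first by rewrite addn0.
  rewrite addnS /=; case: eqP => [xy|_] //.
  by exfalso; apply: nk; exists (n + k).+1 => //; rewrite -addnS leq_addr.
elim=> [|N [n IH]]; first by exists 0%N.
have [[//|k] nk xk] := vis n.+1; exists k.+1; rewrite /= xk eqxx add1n ltnS.
by rewrite (leq_trans IH) // count_hist_le.
Qed.

(** A nearest neighbour trajectory cannot jump over a site. *)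
Lemma crossing (u : int) k l : (k <= l)%N -> x k < u -> u < x l ->
  exists2 m, (k <= m)%N & x m = u.
Proof.
move=> /subnKC <-; elim: (l - k)%N => [|i IH] xu; first by rewrite addn0 => ux; lia.
rewrite addnS => ux; have [/(IH xu)//|] := ltP u (x (k + i)%N).
rewrite le_eqVlt => /orP[/eqP ?|lt_u]; first by exists (k + i)%N; rewrite ?leq_addr.
by case: (x_adj (k + i)); lia.
Qed.

Lemma recurrent_between (y u z : int) :
  recurrent y -> recurrent z -> y <= u <= z -> recurrent u.
Proof.
move=> ry rz; have [->//|uy] := eqVneq u y; have [->//|uz] := eqVneq u z.
move=> /andP[yu uz']; apply/recurrentP => n.
have [k nk xk] := (recurrentP y).1 ry n; have [l kl xl] := (recurrentP z).1 rz k.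
have [||m km xm] := @crossing u k l kl; [by rewrite xk; lia|by rewrite xl; lia|].
by exists m => //; exact: leq_trans km.
Qed.

(** Recurrent sites form an interval: if [m] is the least of them and [m + 5]
    were recurrent, there would be at least six. *)
Lemma recurrent5 : [set y | recurrent y] #= `I_5 ->
  exists m, [/\ recurrent m, ~ recurrent (m - 1) & ~ recurrent (m + 5)].
Proof.
move=> S5.
have [s Ss] : exists s : seq int, [set y | recurrent y] = [set` s].
  by apply/finite_seqP/finite_setP; exists 5%N.
have Sin y : recurrent y <-> y \in s.
  by have := congr1 (fun A : set int => A y) Ss => /= ->.
have [m ms m_min] : exists2 m, m \in s & forall y, y \in s -> m <= y.
  have : s != [::].
    apply/eqP => s0; have : `I_5 #<= [set y | recurrent y].
      by move: S5; rewrite card_eq_le => /andP[].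
    have -> : [set y | recurrent y] = set0 by rewrite Ss s0; apply/seteqP; split.
    by move=> /card_le_trans/(_ (card_ge0 _ `I_0)); rewrite card_le_II.
  elim: s {Ss Sin} => // y s IH _; have [->|/IH[m ms m_min]] := eqVneq s [::].
    by exists y; rewrite ?mem_head // => z; rewrite inE => /eqP ->.
  have [ym|/ltW my] := leP y m.
    exists y; rewrite ?mem_head // => z; rewrite inE => /orP[/eqP -> //|/m_min].
    exact: le_trans.
  exists m; rewrite ?inE ?ms ?orbT // => z; rewrite inE => /orP[/eqP -> //|/m_min //].
have rm : recurrent m by exact/Sin.
exists m; split => //; first by move=> /Sin/m_min; lia.
move=> r5.
have sub : [set m + i%:Z | i in `I_6] `<=` [set y | recurrent y].
  move=> _ [i /= i6 <-]; apply: recurrent_between rm r5 _; lia.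
have inj : {in `I_6 &, injective (fun i : nat => m + i%:Z)}.
  by move=> i j _ _ /addrI [].
have := card_esym (inj_card_eq inj); rewrite card_eq_le => /andP[I6 _].
have := card_le_trans I6 (subset_card_le sub).
move: S5; rewrite card_eq_le => /andP[S5 _] /card_le_trans/(_ S5).
by rewrite card_le_II.
Qed.

End InfinitelyVisited.

Section Assembly.
Context (R : realType) (d : measure_display) (T : measurableType d).
Context (X : nat -> T -> int) (X0 : forall t, X 0%N t = 0).

Lemma inf_visitedE t :
  inf_visited R X t = [set y | recurrent (X^~ t) y].
Proof.
have lE n y : local_time X n y t = count_mem y (hist (X^~ t) n) by rewrite count_hist.
have nd y : {homo (fun n => ((local_time X n y t)%:R : R)%:E) :
    m n / (m <= n)%N >-> (m <= n)%E}.
  move=> m n mn; rewrite lee_fin ler_nat /local_time leq_add2l.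
  by rewrite (big_cat_nat (_ : 1 <= m.+1)%N (_ : m.+1 <= n.+1)%N) //= leq_addr.
apply/seteqP; split=> y /=; rewrite /inf_visited /= /local_time_oo.
  move=> lim N; apply: contrapT => /forallNP nN.
  suff : (+oo <= (N%:R : R)%:E)%E by rewrite leye_eq.
  rewrite -lim; apply: lime_le; first exact: ereal_nondecreasing_is_cvgn.
  apply: nearW => n; rewrite lee_fin ler_nat lE ltnW // ltnNge.
  exact/negP/nN.
move=> rec; rewrite (cvg_lim _ (ereal_nondecreasing_cvgn (nd y))) //.
apply: eq_infty => r; have [n rn] := rec (Num.truncn r).+1.
apply: le_trans (ereal_sup_ubound (ex_intro2 _ _ n I erefl)).
by rewrite lee_fin lE (le_trans (ltW (truncnS_gt r))) // ler_nat.
Qed.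

(** The event is a countable union, over the finite sets of sites with five
    elements. *)
Lemma measurable_five (w : nat -> R) (P : probability T R) :
  is_VRRW P w X -> measurable [set t | inf_visited R X t #= `I_5].
Proof.
move=> X_VRRW; pose A y := [set t | recurrent (X^~ t) y].
have mA y : measurable (A y).
  rewrite (_ : A y = \bigcap_N \bigcup_n
      [set t | (N <= count_mem y (hist (X^~ t) n))%N]); last first.
    apply/seteqP; split=> t rec N; first by have [n] := rec N; exists n.
    by have [n _ Zn] := rec N I; exists n.
  apply: bigcapT_measurable => N; apply: bigcupT_measurable => n.
  exact: (measurable_hist X_VRRW n (fun h => (N <= count_mem y h)%N)).
have mI (F : int -> set T) : (forall y, measurable (F y)) -> measurable (\bigcap_y F y).
  move=> mF; rewrite -(setCK (\bigcap_y F y)) setC_bigcap; apply: measurableC.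
  by apply: countable_bigcupT_measurable => [|y]; [exact: countableP|exact: measurableC].
pose D (s : seq int) : set T := if `[< [set` s] #= `I_5 >] then
  \bigcap_y (if y \in s then A y else ~` A y) else set0.
rewrite (_ : mkset _ = \bigcup_s D s).
  apply: countable_bigcupT_measurable => [|s]; first exact: countableP.
  rewrite /D; case: asboolP => // _; apply: mI => y; case: ifP => // _; exact: measurableC.
apply/seteqP; split=> t /=; rewrite inf_visitedE.
  move=> five; have [s Ss] : exists s : seq int, [set y | recurrent (X^~ t) y] = [set` s].
    by apply/finite_seqP/finite_setP; exists 5%N.
  exists s => //; rewrite /D; case: asboolP => [_|]; last by rewrite -Ss.
  move=> y _; have := congr1 (fun B : set int => B y) Ss; rewrite /A /=.
  by case: ifP => _ /= ->.
move=> [s _]; rewrite /D; case: asboolP => // s5 rec; congr (is_true (_ #= _)): s5.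
apply/seteqP; split=> y /=; have := rec y I.
  by move=> /[swap] ->.
by case: ifP.
Qed.

End Assembly.

(** * The theorem *)

Theorem theorem1p1 (R : realType) (w : nat -> R)
  (w_gt0 : forall n, 0 < w n)
  (w_nondecreasing : {homo w : m n / (m <= n)%N >-> m <= n})
  (w_div : (\sum_(0 <= n <oo) ((w n)^-1)%:E = +oo)%E)
  (d : measure_display) (T : measurableType d) (P : probability T R)
  (X : nat -> T -> int) (X_VRRW : is_VRRW P w X) :
  (0 < P [set o | inf_visited R X o #= `I_5])%E -> (beta_c w < +oo)%E.
Proof.
move=> P5; have [Xm X0 _] := X_VRRW.
have [N [mN PN typN]] := ae_typical w_gt0 X_VRRW w_nondecreasing.
have [t five t_typ] : exists2 t, inf_visited R X t #= `I_5 & typical w (X^~ t).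
  apply: contrapT => nt.
  suff : (P [set o | inf_visited R X o #= `I_5] <= 0)%E by rewrite leNgt P5.
  rewrite -PN; apply: le_measure; rewrite ?inE //; first exact: (measurable_five X0 X_VRRW).
  by move=> t five; apply: typN => typ; apply: nt; exists t.
rewrite inf_visitedE // in five.
have x_adj n : adjacent (X n t) (X n.+1 t) by case: t_typ => [[_ /(_ n)]].
have [m [rm rl rr]] := recurrent5 x_adj five.
have bounded y : ~ recurrent (X^~ t) y ->
    exists B, forall n, (count_mem y (hist (X^~ t) n) <= B)%N.
  move=> /existsNP[B nB]; exists B => n; rewrite leqNgt; apply/negP => lt.
  by apply: nB; exists n; exact: ltnW.
have [[Bl ZBl] [Br ZBr]] := (bounded _ rl, bounded _ rr).
(* The center [m + 2] is written so that outward steps are added one by one. *)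
have er : m + 1 + 1 + 1 + 1 + 1 = m + 5 by ring.
have el : m + 1 + 1 - 1 - 1 = m by ring.
have [|||beta [beta0 [C leC]]] :=
    @summable_levels R w w_gt0 w_nondecreasing (X^~ t) t_typ (m + 1 + 1) (maxn Bl Br).
- by move=> n; rewrite er (leq_trans (ZBr n)) // leq_maxr.
- by move=> n; rewrite el (leq_trans (ZBl n)) // leq_maxl.
- by move=> M; rewrite el; exact: rm.
apply: (beta_c_lt_oo w_gt0 w_nondecreasing w_div beta0 (C := C)).
apply: leC => j; first by rewrite ltW // wextV_gt0.
by move=> k; exact: levelV_le.
Qed.
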